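(* Let $r, n_u \geq 1$, let $M, C \in \mathbb{R}^{r\times r}$ and $B \in \mathbb{R}^{r \times n_u}$ be constant matrices, and let $g: \mathbb{R}^r \to \mathbb{R}$ be a differentiable function. Consider the system $$M\ddot{x}(t) + C\dot{x}(t) + \nabla g(x(t)) = B u(t), \qquad x(t) \in \mathbb{R}^r,\ u(t) \in \mathbb{R}^{n_u}.$$ Suppose that: (I) $M = M^{\mathrm{T}} \succ 0$ (symmetric positive definite); (II) $C = C^{\mathrm{T}} \succ 0$ (symmetric positive definite); (III) $g$ is positive definite (as a function); (IV) there exists $g_0 > 0$ such that $x^{\mathrm{T}} \nabla g(x) \geq g_0 \|x\|^2$ for all $x \in \mathbb{R}^r$. Then the system is input-to-state stable (ISS).
   Context: The full state is $z(t) := \begin{bmatrix} x(t)^{\mathrm{T}} & \dot{x}(t)^{\mathrm{T}}\end{bmatrix}^{\mathrm{T}} \in \mathbb{R}^{2r}$, $\|\cdot\|$ is the Euclidean norm, and for a signal $u:[0,\infty)\to\mathbb{R}^{n_u}$, $\|u\|_\infty := \sup_{t\in[0,\infty)}\|u(t)\|$. A solution for an input $u$ is a twice differentiable function $x:[0,\infty)\to\mathbb{R}^r$ satisfying the equation for all $t\geq 0$. A $\mathcal{K}$-function is a function $\alpha:[0,\infty)\to[0,\infty)$ that is continuous, strictly increasing, with $\alpha(0)=0$. A $\mathcal{KL}$-function is a function $\beta:[0,\infty)\times[0,\infty)\to[0,\infty)$ such that $\beta(\cdot,t)$ is a $\mathcal{K}$-function for each $t\geq 0$ and $\lim_{t\to\infty}\beta(s,t)=0$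 for each $s\geq 0$. Input-to-state stability: the system is ISS if there exist a $\mathcal{KL}$-function $\beta$ and a $\mathcal{K}$-function $\gamma$ such that, for every input $u$ with $\|u\|_\infty<\infty$, every corresponding solution satisfies $$\|z(t)\| \leq \beta(\|z(0)\|, t) + \gamma(\|u\|_\infty) \quad \text{for all } t \geq 0.$$ A function $\theta:\mathbb{R}^m\to\mathbb{R}$ is positive definite if $\theta(0)=0$ and $\theta(x)>0$ for all $x\neq 0$. *)

(* Defs.v *)
From HB Require Import structures.
From mathcomp Require Import all_boot all_order all_algebra.
From mathcomp Require Import all_classical all_reals all_analysis.

Set Implicit Arguments.
Unset Strict Implicit.
Unset Printing Implicit Defensive.

Import Order.TTheory GRing.Theory Num.Theory.
Import numFieldNormedType.Exports.

Local Open Scope classical_set_scope.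
Local Open Scope ring_scope.

(* The library norm [`|v|] on matrices is the sup norm, so the Euclidean norm
   is defined separately. Limits and differentiability of vector-valued
   functions use the library topology; in finite dimension all norms give the
   same one. *)
Definition enorm (R : realType) (n : nat) (v : 'cV[R]_n) : R :=
  Num.sqrt (\sum_(i < n) v i 0 ^+ 2).

Definition posdefmx (R : realType) (n : nat) (A : 'M[R]_n) : Prop :=
  forall v : 'cV[R]_n, v != 0 -> 0 < (v^T *m A *m v) 0 0.

Definition posdef_fun (R : realType) (m : nat) (f : 'cV[R]_m -> R) : Prop :=
  f 0 = 0 /\ forall x, x != 0 -> 0 < f x.

Definition gradient (R : realType) (n : nat) (g : 'cV[R]_n -> R)
    (x : 'cV[R]_n) : 'cV[R]_n :=
  \col_(i < n) 'D_(delta_mx i 0) g x.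

(* Functions on [0, +oo[ are represented by total functions on R of which only
   the restriction to [0, +oo[ is ever used. Accordingly, the derivative at t
   is the limit of the difference quotient along points of [0, +oo[; it is
   two-sided for t > 0 and one-sided at t = 0. *)
Section HalfLineDerivative.
Context (R : realType) (V : normedModType R).

Definition hquot (f : R -> V) (t s : R) : V := (s - t)^-1 *: (f s - f t).

Definition hderivable (f : R -> V) (t : R) : Prop :=
  cvg (hquot f t s @[s --> within `[0, +oo[ t^']).

Definition hderive (f : R -> V) (t : R) : V :=
  lim (hquot f t s @[s --> within `[0, +oo[ t^']).

End HalfLineDerivative.

Definition signal_norm (R : realType) (n : nat) (u : R -> 'cV[R]_n) : \bar R :=
  ereal_sup [set (enorm (u t))%:E | t in `[0, +oo[].

Definition K_function (R : realType) (alpha : R -> R) : Prop :=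
  [/\ forall s : R, 0 <= s -> 0 <= alpha s,
      {within `[0, +oo[, continuous alpha},
      forall s1 s2 : R, 0 <= s1 -> s1 < s2 -> alpha s1 < alpha s2
    & alpha 0 = 0].

(* No monotonicity or continuity in the second argument is required. *)
Definition KL_function (R : realType) (beta : R -> R -> R) : Prop :=
  (forall t : R, 0 <= t -> K_function (beta^~ t)) /\
  (forall s : R, 0 <= s -> beta s t @[t --> +oo] --> (0 : R)).

Definition is_solution (R : realType) (r nu : nat) (M C : 'M[R]_r)
    (B : 'M[R]_(r, nu)) (g : 'cV[R]_r -> R)
    (u : R -> 'cV[R]_nu) (x : R -> 'cV[R]_r) : Prop :=
  forall t : R, 0 <= t ->
    [/\ hderivable x t,
        hderivable (hderive x) t
      & M *m hderive (hderive x) t + C *m hderive x t + gradient g (x t)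
        = B *m u t].

Definition full_state (R : realType) (r : nat) (x : R -> 'cV[R]_r) (t : R) :
    'cV[R]_(r + r) :=
  col_mx (x t) (hderive x t).

Definition ISS (R : realType) (r nu : nat) (M C : 'M[R]_r)
    (B : 'M[R]_(r, nu)) (g : 'cV[R]_r -> R) : Prop :=
  exists beta : R -> R -> R, exists gamma : R -> R,
    [/\ KL_function beta, K_function gamma
      & forall u : R -> 'cV[R]_nu, (signal_norm u < +oo)%E ->
        forall x : R -> 'cV[R]_r, is_solution M C B g u x ->
        forall t : R, 0 <= t ->
          enorm (full_state x t) <=
          beta (enorm (full_state x 0)) t + gamma (fine (signal_norm u))].

(* Main.v *)
Require Import Defs.
From mathcomp Require Import all_boot all_order all_algebra.
From mathcomp Require Import all_classical all_reals all_analysis.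
From mathcomp Require Import ring lra.

Set Implicit Arguments.
Unset Strict Implicit.
Unset Printing Implicit Defensive.

Import Order.TTheory GRing.Theory Num.Theory.
Import numFieldNormedType.Exports.

Local Open Scope classical_set_scope.
Local Open Scope ring_scope.

(** Write v for the derivative of x, z for the pair (x, v) and N for its
    Euclidean norm.  The plain energy v^T M v / 2 + g(x) decreases only
    through v, so a cross term is added: for small e > 0 put
      V = v^T M v / 2 + g(x) + e x^T M v + (e / 2) x^T C x.
    The last term is chosen so that, along solutions, the mixed products
    x^T C v cancel and
      V' = - v^T C v + e v^T M v - e x^T grad g(x) + (v + e x)^T B u.
    Since M and C are coercive and x^T grad g(x) >= g0 |x|^2, small e gives
    V >= a1 N^2 (lyapunov_ge) and V' <= - a N^2 as soon as N is at least a fixed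
    multiple k |u|_oo of the input (is_derive_lyapunov, lyapunov_dissipation).

    From above V is not bounded by a multiple of N^2, because g may grow
    arbitrarily fast; only V <= alpha(N) holds, with alpha a K-function obtained
    from the supremum of g over dilated cubes (majorant_K).  The decay is
    therefore not exponential, and it is extracted by one application of the mean
    value theorem on [0, t] instead of a comparison theorem for differential
    inequalities.  At some time tau in ]0, t[,
    V(t) - V(0) = t V'(tau).  Either N(tau) < k |u|_oo, or
    a t N(tau)^2 <= V(0) <= alpha(N(0)); so V(tau) is at most the larger of
    alpha(k |u|_oo) and alpha(sqrt(alpha(N(0)) / (a t))).  Every sublevel set of
    V containing the level alpha(k |u|_oo) is forward invariant
    (sublevel_invariant), so the same bound holds at t (dissipation_bound).
    Taking square roots through a1 N^2 <= V gives explicit comparison functions: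
    the gain is gamma(U) = sqrt(alpha(k U) / a1), and the decay function is
    beta(s, t) = sqrt(alpha(sqrt(alpha(s) / (a t))) / a1) for t > 0, a K-function
    of s at each t, tending to 0 as t grows. *)

(** * Bilinear forms and Euclidean norms *)

Definition bilin (R : realType) (n : nat) (A : 'M[R]_n) (u v : 'cV[R]_n) : R :=
  (u^T *m A *m v) 0 0.

Lemma bilinE (R : realType) (n : nat) (A : 'M[R]_n) (u v : 'cV[R]_n) :
  bilin A u v = \sum_i \sum_j u i 0 * A i j * v j 0.
Proof.
rewrite /bilin mxE exchange_big /=; apply: eq_bigr => j _.
by rewrite !mxE big_distrl /=; apply: eq_bigr => i _; rewrite !mxE.
Qed.

Lemma bilinDl (R : realType) (n : nat) (A : 'M[R]_n) (u v w : 'cV[R]_n) :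
  bilin A (u + v) w = bilin A u w + bilin A v w.
Proof. by rewrite /bilin linearD /= !mulmxDl mxE. Qed.

Lemma bilinDr (R : realType) (n : nat) (A : 'M[R]_n) (u v w : 'cV[R]_n) :
  bilin A u (v + w) = bilin A u v + bilin A u w.
Proof. by rewrite /bilin mulmxDr mxE. Qed.

Lemma bilinZl (R : realType) (n : nat) (A : 'M[R]_n) (c : R) (u v : 'cV[R]_n) :
  bilin A (c *: u) v = c * bilin A u v.
Proof. by rewrite /bilin linearZ /= -!scalemxAl mxE. Qed.

Lemma bilinZr (R : realType) (n : nat) (A : 'M[R]_n) (c : R) (u v : 'cV[R]_n) :
  bilin A u (c *: v) = c * bilin A u v.
Proof. by rewrite /bilin -scalemxAr mxE. Qed.

Lemma bilin_sym (R : realType) (n : nat) (A : 'M[R]_n) (u v : 'cV[R]_n) :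
  A = A^T -> bilin A u v = bilin A v u.
Proof.
move=> As; rewrite /bilin -(trmxK (u^T *m A *m v)) mxE.
by rewrite !trmx_mul trmxK -As mulmxA.
Qed.

Lemma posdef_bilin_ge0 (R : realType) (n : nat) (A : 'M[R]_n) (u : 'cV[R]_n) :
  posdefmx A -> 0 <= bilin A u u.
Proof.
move=> Apos; have [->|u0] := eqVneq u 0; last exact/ltW/Apos.
by rewrite /bilin mulmx0 mxE.
Qed.

(** Evaluate the form at (v^T A v) u - (u^T A v) v and divide the resulting
    nonnegative quantity by v^T A v.  It is used both for A = 1, where it is the
    usual inequality, and for the coercivity of A itself. *)
Lemma posdef_cauchy_schwarz (R : realType) (n : nat) (A : 'M[R]_n)
    (u v : 'cV[R]_n) : A = A^T -> posdefmx A ->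
  bilin A u v ^+ 2 <= bilin A u u * bilin A v v.
Proof.
move=> As Ap; have [->|v0] := eqVneq v 0.
  by rewrite /bilin !mulmx0 mxE mulr0 expr0n.
have vv : 0 < bilin A v v by exact: Ap.
have := posdef_bilin_ge0 (bilin A v v *: u - bilin A u v *: v) Ap.
rewrite -scaleNr bilinDl !bilinDr !bilinZl !bilinZr (bilin_sym v u As).
set a := bilin A u u; set b := bilin A u v; set c := bilin A v v in vv *.
have -> : c * (c * a) + c * (- b * b) + (- b * (c * b) + - b * (- b * c)) =
  c * (a * c - b ^+ 2) by ring.
by rewrite pmulr_rge0 // subr_ge0.
Qed.

Lemma enorm_ge0 (R : realType) (n : nat) (v : 'cV[R]_n) : 0 <= enorm v.
Proof. exact: sqrtr_ge0. Qed.

Lemma sqr_enorm (R : realType) (n : nat) (v : 'cV[R]_n) :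
  enorm v ^+ 2 = \sum_i v i 0 ^+ 2.
Proof. by rewrite sqr_sqrtr // sumr_ge0 // => i _; exact: sqr_ge0. Qed.

Lemma bilin1E (R : realType) (n : nat) (u v : 'cV[R]_n) :
  bilin 1%:M u v = \sum_i u i 0 * v i 0.
Proof. by rewrite /bilin mulmx1 mxE; apply: eq_bigr => i _; rewrite mxE. Qed.

Lemma bilin1_sqr (R : realType) (n : nat) (v : 'cV[R]_n) :
  bilin 1%:M v v = enorm v ^+ 2.
Proof. by rewrite bilin1E sqr_enorm; apply: eq_bigr => i _; rewrite expr2. Qed.

Lemma enorm_eq0 (R : realType) (n : nat) (v : 'cV[R]_n) :
  (enorm v == 0) = (v == 0).
Proof.
apply/eqP/eqP => [v0|->]; last first.
  by rewrite /enorm big1 ?sqrtr0 // => i _; rewrite mxE expr0n.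
apply/colP => i; rewrite mxE; apply/eqP; rewrite -sqrf_eq0.
have /psumr_eq0P : \sum_i v i 0 ^+ 2 = 0 by rewrite -sqr_enorm v0 expr0n.
by move=> -> // j _; exact: sqr_ge0.
Qed.

Lemma posdef1 (R : realType) (n : nat) : posdefmx (1%:M : 'M[R]_n).
Proof.
move=> v v0; change (0 < bilin 1%:M v v).
by rewrite bilin1_sqr exprn_gt0 // lt_def enorm_ge0 enorm_eq0 v0.
Qed.

Lemma dot_le_enorm (R : realType) (n : nat) (u v : 'cV[R]_n) :
  `|bilin 1%:M u v| <= enorm u * enorm v.
Proof.
rewrite -ler_sqr ?nnegrE ?mulr_ge0 ?enorm_ge0 // real_normK ?num_real //.
rewrite exprMn -!bilin1_sqr; apply: posdef_cauchy_schwarz (@posdef1 R n).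
by rewrite trmx1.
Qed.

Definition frobenius (R : realType) (m n : nat) (A : 'M[R]_(m, n)) : R :=
  Num.sqrt (\sum_i \sum_j A i j ^+ 2).

Lemma frobenius_ge0 (R : realType) (m n : nat) (A : 'M[R]_(m, n)) :
  0 <= frobenius A.
Proof. exact: sqrtr_ge0. Qed.

Lemma enorm_mulmx (R : realType) (m n : nat) (A : 'M[R]_(m, n)) (v : 'cV[R]_n) :
  enorm (A *m v) <= frobenius A * enorm v.
Proof.
rewrite -ler_sqr ?nnegrE ?mulr_ge0 ?enorm_ge0 ?frobenius_ge0 // exprMn.
rewrite [frobenius A ^+ 2]sqr_sqrtr; last first.
  by apply: sumr_ge0 => i _; apply: sumr_ge0 => j _; exact: sqr_ge0.
rewrite sqr_enorm big_distrl /=; apply: ler_sum => i _.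
have -> : (A *m v) i 0 = bilin 1%:M (row i A)^T v.
  by rewrite bilin1E mxE; apply: eq_bigr => j _; rewrite !mxE.
have -> : \sum_j A i j ^+ 2 = enorm (row i A)^T ^+ 2.
  by rewrite sqr_enorm; apply: eq_bigr => j _; rewrite !mxE.
rewrite -exprMn -[X in X <= _]real_normK ?num_real //.
by rewrite ler_sqr ?nnegrE ?mulr_ge0 ?enorm_ge0 // dot_le_enorm.
Qed.

Lemma bilin_le (R : realType) (n : nat) (A : 'M[R]_n) (u v : 'cV[R]_n) :
  `|bilin A u v| <= frobenius A * (enorm u * enorm v).
Proof.
have -> : bilin A u v = bilin 1%:M u (A *m v) by rewrite /bilin mulmx1 mulmxA.
apply: le_trans (dot_le_enorm _ _) _; rewrite mulrCA.
by rewrite ler_wpM2l ?enorm_ge0 ?enorm_mulmx.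
Qed.

Lemma posdef_unitmx (R : realType) (n : nat) (A : 'M[R]_n) :
  posdefmx A -> A \in unitmx.
Proof.
move=> Ap; rewrite -row_free_unit -kermx_eq0; apply/eqP/row_matrixP => i.
rewrite row0; apply/eqP; case: eqVneq => // k0.
have := Ap (row i (kermx A))^T; rewrite trmxK.
have /sub_kermxP-> : (row i (kermx A) <= kermx A)%MS by exact: row_sub.
rewrite mul0mx mxE ltxx; apply; apply: contra_neq k0 => /(congr1 trmx).
by rewrite trmxK trmx0.
Qed.

(** Compactness of the sphere is avoided: with w = A^-1 v one has
    |v|^2 = v^T A w, so Cauchy-Schwarz for A gives
    |v|^4 <= (v^T A v) (w^T A w), and w^T A w = w^T v <= |A^-1| |v|^2. *)
Lemma posdef_coercive (R : realType) (n : nat) (A : 'M[R]_n) :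
  A = A^T -> posdefmx A ->
  exists2 m : R, 0 < m & forall v : 'cV[R]_n, m * enorm v ^+ 2 <= bilin A v v.
Proof.
move=> As Ap.
(* Adding 1 keeps the constant positive in dimension zero. *)
pose F := frobenius (invmx A) + 1.
have F0 : 0 < F by rewrite ltr_wpDl ?frobenius_ge0.
exists F^-1; first by rewrite invr_gt0.
move=> v; rewrite mulrC ler_pdivrMr // mulrC.
have [->|v0] := eqVneq v 0.
  have /eqP-> : enorm (0 : 'cV[R]_n) == 0 by rewrite enorm_eq0.
  by rewrite expr0n /= mulr_ge0 ?(ltW F0) // posdef_bilin_ge0.
have v2 : 0 < enorm v ^+ 2.
  by rewrite exprn_gt0 // lt_def enorm_ge0 enorm_eq0 v0.
pose w := invmx A *m v.
have Aw : A *m w = v by rewrite mulKVmx // posdef_unitmx.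
have vw : bilin A v w = enorm v ^+ 2.
  by rewrite -bilin1_sqr /bilin mulmx1 -mulmxA Aw.
have ww : bilin A w w <= F * enorm v ^+ 2.
  have -> : bilin A w w = bilin 1%:M w v by rewrite /bilin mulmx1 -mulmxA Aw.
  apply: le_trans (ler_norm _) _; apply: le_trans (dot_le_enorm _ _) _.
  rewrite expr2 mulrA ler_wpM2r ?enorm_ge0 //.
  apply: le_trans (enorm_mulmx _ _) _.
  by rewrite ler_wpM2r ?enorm_ge0 // lerDl.
have := posdef_cauchy_schwarz v w As Ap; rewrite vw expr2 => cs.
rewrite -(ler_pM2r v2); apply: le_trans cs _.
rewrite [X in _ <= X](_ : _ = bilin A v v * (F * enorm v ^+ 2)); last by ring.
by rewrite ler_wpM2l // posdef_bilin_ge0.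
Qed.

(** * Decay from a dissipation inequality *)

(** Continuity on the closed half line, one-sided at 0; this is the notion that
    half-line derivatives provide at the initial time. *)
Definition hcontinuous (R : realType) (V : topologicalType) (f : R -> V)
    (t : R) : Prop :=
  f s @[s --> within `[0, +oo[ (nbhs t)] --> f t.

Lemma half_line_MVT (R : realType) (f df : R -> R) (a b : R) :
  (forall t : R, 0 <= t -> hcontinuous f t) ->
  (forall t : R, 0 < t -> is_derive t 1 f (df t)) ->
  0 <= a -> a < b ->
  exists2 c, a < c < b & f b - f a = df c * (b - a).
Proof.
move=> fc fd a0 ab.
have [| |c] := @MVT R f df a b ab.
- by move=> t /[!in_itv]/= /andP[at_ _]; apply: fd; exact: le_lt_trans at_.
- apply: (@continuous_subspaceW _ _ `[a, b] `[0, +oo[) => [t|].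
    by rewrite /= !in_itv /= andbT => /andP[/(le_trans a0)].
  by apply/subspace_continuousP => t; rewrite /= in_itv /= andbT; exact: fc.
by rewrite in_itv /= => cab E; exists c.
Qed.

(** If V were above c at time t, look at the last earlier time at which V is at
    most c: from there on V exceeds c, hence does not increase, which contradicts
    the mean value theorem.  The sign condition is asked only above c: inside the
    sublevel set the input may make V grow. *)
Lemma sublevel_invariant (R : realType) (V dV : R -> R) (c s t : R) :
  (forall t : R, 0 <= t -> hcontinuous V t) ->
  (forall t : R, 0 < t -> is_derive t 1 V (dV t)) ->
  (forall t : R, 0 < t -> c < V t -> dV t <= 0) ->
  0 <= s -> s <= t -> V s <= c -> V t <= c.
Proof.
move=> Vc Vd dV0 s0 st Vs; rewrite leNgt; apply/negP => Vt.
pose E := [set x | s <= x <= t /\ V x <= c].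
have Es : E s by split; rewrite ?lexx.
have Eub : ubound E t by move=> x [/andP[]].
have Esup : has_sup E by split; [exists s | exists t].
have sS : s <= sup E by apply: ub_le_sup => //; exists t.
have St : sup E <= t by apply: ge_sup => //; exists s.
have S0 : 0 <= sup E := le_trans s0 sS.
have VS : V (sup E) <= c.
  rewrite leNgt; apply/negP => VS.
  have : \forall x \near within `[0, +oo[ (nbhs (sup E)), c < V x.
    by move/cvgr_gt: (Vc _ S0); apply.
  rewrite near_withinE => /nbhs_ballP[e /= e0 He].
  have [x Ex xS] := sup_adherent e0 Esup.
  have xE : x <= sup E by apply: ub_le_sup => //; exists t.
  have /= := He x.
  rewrite /ball /= ger0_norm ?subr_ge0 // ltrBlDr -ltrBlDl => /(_ xS).
  case: Ex => /andP[sx _] Vx.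
  by rewrite in_itv /= (le_trans s0 sx) /= => /(_ isT); rewrite ltNge Vx.
have SLt : sup E < t.
  by rewrite lt_neqAle St andbT; apply: contraTneq VS => ->; rewrite -ltNge.
have [x /andP[Sx xt] Ex] := half_line_MVT Vc Vd S0 SLt.
have x0 : 0 < x := le_lt_trans S0 Sx.
have Vx : c < V x.
  rewrite ltNge; apply/negP => Vx; suff : x <= sup E by rewrite leNgt Sx.
  apply: ub_le_sup; first by exists t.
  by split; rewrite // (ltW xt) (ltW (le_lt_trans sS Sx)).
have : V t - V (sup E) <= 0.
  by rewrite Ex mulr_le0_ge0 ?dV0 // subr_ge0.
by rewrite subr_le0 => /le_trans /(_ VS); rewrite leNgt Vt.
Qed.

(** The point x of the mean value theorem on [0, t] does the work.  If N(x) is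
    below rho, then V(x) <= alpha(rho).  Otherwise a t N(x)^2 <= V(0) - V(t) is at
    most alpha(N(0)), which bounds N(x), hence V(x).  The level c is at least
    alpha(rho), so it is invariant and the bound at x passes to t. *)
Lemma dissipation_bound (R : realType) (V dV N alpha : R -> R) (a rho t : R) :
  (forall t : R, 0 <= t -> hcontinuous V t) ->
  (forall t : R, 0 < t -> is_derive t 1 V (dV t)) ->
  (forall t : R, 0 <= t -> 0 <= V t) ->
  (forall t : R, 0 <= t -> 0 <= N t) ->
  (forall t : R, 0 <= t -> V t <= alpha (N t)) ->
  (forall s1 s2 : R, 0 <= s1 -> s1 <= s2 -> alpha s1 <= alpha s2) ->
  0 < a -> 0 <= rho ->
  (forall t : R, 0 < t -> rho <= N t -> dV t <= - (a * N t ^+ 2)) ->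
  0 < t ->
  V t <= Num.max (alpha (Num.sqrt (alpha (N 0) / (a * t)))) (alpha rho).
Proof.
move=> Vc Vd V0 N0 Val almon a0 rho0 dVN t0; set c := Num.max _ _.
have [x /andP[x0 xt] Ex] := half_line_MVT Vc Vd (lexx 0) t0.
apply: (@sublevel_invariant R V dV c x t) => //; try exact: ltW.
- move=> y y0 cV; suff rN : rho <= N y.
    by apply: le_trans (dVN y y0 rN) _; rewrite oppr_le0 mulr_ge0 ?sqr_ge0 ?ltW.
  rewrite leNgt; apply: contraTN cV => Ny; rewrite -leNgt le_max; apply/orP; right.
  by apply: le_trans (Val y (ltW y0)) (almon _ _ _ _); rewrite ?N0 ?ltW.
- have x0' := ltW x0; apply: le_trans (Val x x0') _; rewrite le_max.
  have [Nx|rN] := leP (N x) rho; first by rewrite [X in _ || X]almon ?orbT ?N0.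
  apply/orP; left; apply: almon; rewrite ?N0 //.
  rewrite -(ger0_norm (N0 x x0')) -sqrtr_sqr ler_wsqrtr //.
  rewrite ler_pdivlMr ?mulr_gt0 //; apply: le_trans (Val 0 (lexx 0)).
  have := dVN x x0 (ltW rN); have := V0 t (ltW t0).
  move: Ex; rewrite subr0 => Ex Vt.
  rewrite -(ler_pM2r t0) -Ex; lra.
Qed.

(** * Comparison functions *)

(** K-functions that extend continuously to the whole line: this variant is stable
    under composition without tracking domains of continuity. *)
Definition everywhere_K (R : realType) (f : R -> R) : Prop :=
  [/\ continuous f, f 0 = 0 & forall s1 s2 : R, 0 <= s1 -> s1 < s2 -> f s1 < f s2].

Lemma everywhere_K_ge0 (R : realType) (f : R -> R) (s : R) :
  everywhere_K f -> 0 <= s -> 0 <= f s.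
Proof.
move=> [_ f0 fi]; rewrite le_eqVlt => /predU1P[<-|s0]; first by rewrite f0.
by rewrite -f0 ltW // fi.
Qed.

Lemma everywhere_K_le (R : realType) (f : R -> R) (s1 s2 : R) :
  everywhere_K f -> 0 <= s1 -> s1 <= s2 -> f s1 <= f s2.
Proof.
by move=> [_ _ fi] s10; rewrite le_eqVlt => /predU1P[->//|/(fi _ _ s10)/ltW].
Qed.

Lemma everywhere_K_K_function (R : realType) (f : R -> R) :
  everywhere_K f -> K_function f.
Proof.
move=> fK; have [fc f0 fi] := fK; split=> //.
  by move=> s; exact: everywhere_K_ge0.
exact: continuous_subspaceT.
Qed.

Lemma everywhere_K_comp (R : realType) (f g : R -> R) :
  everywhere_K f -> everywhere_K g -> everywhere_K (fun s => f (g s)).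
Proof.
move=> fK gK; have [fc f0 fi] := fK; have [gc g0 gi] := gK; split.
- by move=> s; apply: continuous_comp; [exact: gc | exact: fc].
- by rewrite g0.
- by move=> s1 s2 s10 s12; apply: fi; [exact: everywhere_K_ge0 | exact: gi].
Qed.

Lemma everywhere_K_sqrt (R : realType) : everywhere_K (@Num.sqrt R).
Proof.
split; [exact: sqrt_continuous | exact: sqrtr0 |].
by move=> s1 s2 s10 s12; rewrite ltr_sqrt // (le_lt_trans s10).
Qed.

Lemma everywhere_K_scale (R : realType) (c : R) :
  0 < c -> everywhere_K (fun s => c * s).
Proof.
move=> c0; split; [exact: mulrl_continuous | exact: mulr0 |].
by move=> s1 s2 _ s12; rewrite ltr_pM2l.
Qed.

(** The bound of dissipation_bound read back in terms of the norm, with b the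
    inverse of the constant in b^-1 N^2 <= V.  At t = 0 the mean value argument has
    no content and the static bound V <= alpha(N) is used. *)
Definition decay (R : realType) (alpha : R -> R) (a b : R) (s t : R) : R :=
  if t == 0 then Num.sqrt (b * alpha s)
  else Num.sqrt (b * alpha (Num.sqrt ((a * t)^-1 * alpha s))).

Lemma decay_KL (R : realType) (alpha : R -> R) (a b : R) :
  everywhere_K alpha -> 0 < a -> 0 < b -> KL_function (decay alpha a b).
Proof.
move=> aK a0 b0; have sK := everywhere_K_sqrt R.
have bK := everywhere_K_scale b0; split=> [t t0|s s0].
  apply: everywhere_K_K_function; rewrite /decay; case: eqVneq => [_|tn0].
    exact: (everywhere_K_comp sK (everywhere_K_comp bK aK)).
  have cK : everywhere_K (fun s => (a * t)^-1 * s).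
    by apply: everywhere_K_scale; rewrite invr_gt0 mulr_gt0 // lt_def tn0.
  apply: (everywhere_K_comp sK (everywhere_K_comp bK (everywhere_K_comp aK _))).
  exact: (everywhere_K_comp sK (everywhere_K_comp cK aK)).
have [fc f0 _] := everywhere_K_comp sK (everywhere_K_comp bK
  (everywhere_K_comp aK sK)).
have to0 : (a * t)^-1 * alpha s @[t --> +oo] --> (0 : R).
  rewrite -[X in _ --> X](mul0r (alpha s)); apply: cvgMr_tmp.
  apply/cvgrPdist_le => e e0; exists (a * e)^-1; split; first exact: num_real.
  move=> t te; have t0 : 0 < t.
    by apply: lt_trans te; rewrite invr_gt0 mulr_gt0.
  rewrite sub0r normrN gtr0_norm ?invr_gt0 ?mulr_gt0 // ltW //.
  rewrite invf_plt ?posrE ?mulr_gt0 // mulrC -ltr_pdivrMr //.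
  by rewrite -invfM mulrC.
have : Num.sqrt (b * alpha (Num.sqrt ((a * t)^-1 * alpha s))) @[t --> +oo] -->
    (0 : R).
  by rewrite -f0; apply: (continuous_cvg _ (fc 0)) to0.
apply: cvg_trans; apply: near_eq_cvg; exists 0; split; first exact: num_real.
by move=> t t0; rewrite /decay gt_eqF.
Qed.

(** * Radial majorants *)

(** On a compact K joint continuity becomes continuity in s uniform over K, by
    the filter form of compactness; the same argument with the filter at +oo gives
    the upper bound that makes the supremum meaningful. *)
Lemma continuous_sup_compact (R : realType) (X : topologicalType) (K : set X)
    (F : R -> X -> R) : compact K -> K !=set0 ->
  (forall p : R * X, {for p, continuous (fun p => F p.1 p.2)}) ->
  (forall s, has_sup [set F s y | y in K]) /\
  continuous (fun s => sup [set F s y | y in K]).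
Proof.
move=> /compact_near_coveringP Kc [y0 Ky0] Fc.
have Fub s : has_sup [set F s y | y in K].
  split; first by exists (F s y0), y0.
  have [|M [_ HM]] := Kc R +oo (fun M y => F s y <= M).
    move=> y _.
    have /cvgr_lt/(_ (F s y + 1)) : {for (s, y), continuous (fun p => F p.1 p.2)}.
      exact: Fc.
    rewrite ltrDl => /(_ ltr01) [[A B] /= [As By] AB].
    exists (B, [set x | F s y + 1 < x]) => /=.
      by split => //; exists (F s y + 1); rewrite num_real.
    move=> [y' M] [/= By' lt_M]; apply/ltW/(lt_trans _ lt_M).
    exact: (AB (s, y') (conj (nbhs_singleton As) By')).
  by exists (M + 1) => _ [y Ky <-]; apply: HM => //; rewrite ltrDl.
split=> // s; apply/cvgrPdist_le => e e0.
have : \forall s' \near s, forall y, K y -> `|F s' y - F s y| <= e.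
  apply: (Kc R (nbhs s) (fun s' y => `|F s' y - F s y| <= e)) => y _.
  have e20 : 0 < e / 2 by rewrite divr_gt0.
  have /cvgrPdist_le/(_ _ e20) : {for (s, y), continuous (fun p => F p.1 p.2)}.
    exact: Fc.
  move=> [[A B] /= [As By] AB]; exists (B, A) => //= -[y' s'] [/= By' As'].
  have h1 := AB (s', y') (conj As' By').
  have h2 := AB (s, y') (conj (nbhs_singleton As) By').
  move: h1 h2 => /=; rewrite !ler_norml => /andP[h1 h2] /andP[h3 h4].
  by apply/andP; split; lra.
apply: filterS => s' Hs'.
have sup_le a b : (forall y, K y -> F a y <= F b y + e) ->
    sup [set F a y | y in K] <= sup [set F b y | y in K] + e.
  move=> ab; apply: ge_sup; first by exists (F a y0), y0.
  move=> _ [y Ky <-]; apply: le_trans (ab y Ky) _; rewrite lerD2r.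
  by apply: ub_le_sup; [case: (Fub b) | exists y].
rewrite ler_norml; apply/andP; split.
  rewrite lerBrDr addrC lerBlDr.
  by apply: sup_le => y /Hs'; rewrite ler_norml => /andP[_]; lra.
rewrite lerBlDr addrC.
by apply: sup_le => y /Hs'; rewrite ler_norml => /andP[]; lra.
Qed.

Lemma trmx_continuous (R : realType) (m n : nat) :
  continuous (fun A : 'M[R]_(m, n) => A^T).
Proof.
move=> A S /nbhs_ballP[e /= e0 eS]; apply/nbhs_ballP; exists e => //= N [_ AN].
by apply: eS; split=> // i j; rewrite !mxE; exact: AN.
Qed.

Lemma coord_le_enorm (R : realType) (n : nat) (x : 'cV[R]_n) (i : 'I_n) :
  `|x i 0| <= enorm x.
Proof.
rewrite -ler_sqr ?nnegrE ?enorm_ge0 // real_normK ?num_real // sqr_enorm.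
by rewrite (bigD1 i) //= lerDl sumr_ge0 // => j _; exact: sqr_ge0.
Qed.

(** G(s) is the supremum of g over the image of the cube [-1, 1]^n under dilation
    by s.  A dilated fixed compact set turns the dependence on s into a continuous
    parameter, and the cube contains x / |x| for every x <> 0.  The cube consists of
    row vectors, hence the transpositions. *)
Lemma radial_majorant (R : realType) (n : nat) (g : 'cV[R]_n -> R) :
  continuous g -> g 0 = 0 ->
  exists G : R -> R, [/\ continuous G, G 0 = 0,
    forall s1 s2 : R, 0 <= s1 -> s1 <= s2 -> G s1 <= G s2
  & forall x, g x <= G (enorm x)].
Proof.
move=> gc g0.
pose K := [set y : 'rV[R]_n | forall i, `[-1, 1]%classic (y ord0 i)].
have Kc : compact K.
  have /= := @rV_compact R n (fun=> `[-1, 1]%classic).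
  by apply=> _; exact: segment_compact.
have K0 : K 0 by move=> i; rewrite /= mxE in_itv /= lerN10 ler01.
have Fc (p : R * 'rV[R]_n) :
    {for p, continuous (fun q : R * 'rV[R]_n => g (q.1 *: q.2^T))}.
  apply: continuous_comp; last exact: gc.
  apply: cvgZ; first exact: cvg_fst.
  apply: continuous_comp; first exact: cvg_snd.
  exact: trmx_continuous.
have [Gs Gc] := @continuous_sup_compact R _ K (fun s y => g (s *: y^T)) Kc
    (ex_intro _ _ K0) Fc.
pose G s := sup [set g (s *: y^T) | y in K].
have gG s y : K y -> g (s *: y^T) <= G s.
  by move=> Ky; apply: ub_le_sup; [case: (Gs s) | exists y].
exists G; split=> //.
- apply/eqP; rewrite eq_le; apply/andP; split; last first.
    by have := gG 0 0 K0; rewrite scale0r g0.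
  apply: ge_sup; first by exists (g (0 *: 0^T)), 0.
  by move=> _ [y _ <-]; rewrite scale0r g0.
- move=> s1 s2 s10 s12; apply: ge_sup; first by exists (g (s1 *: 0^T)), 0.
  move=> _ [y Ky <-]; have [s20|s20] := eqVneq s2 0.
    have -> : s1 = s2 by apply: le_anti; rewrite s12 s20 s10.
    exact: gG.
  have s2p : 0 < s2 by rewrite lt_def s20 (le_trans s10).
  have -> : s1 *: y^T = s2 *: ((s1 / s2) *: y)^T.
    by rewrite linearZ /= scalerA mulrCA divff // mulr1.
  apply: gG => i; have := Ky i; rewrite /= !in_itv /= mxE -!ler_norml normrM.
  have s2ge := ltW s2p; rewrite ger0_norm ?divr_ge0 // => yi.
  by rewrite mulr_ile1 ?divr_ge0 // ler_pdivrMr // mul1r.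
- move=> x; have [->|x0] := eqVneq x 0.
    have /eqP-> : enorm (0 : 'cV[R]_n) == 0 by rewrite enorm_eq0.
    by have := gG 0 0 K0; rewrite scale0r.
  have xp : 0 < enorm x by rewrite lt_def enorm_ge0 enorm_eq0 x0.
  have xE : enorm x *: ((enorm x)^-1 *: x^T)^T = x.
    by rewrite linearZ /= trmxK scalerA divff ?scale1r // lt0r_neq0.
  rewrite -[X in g X]xE.
  apply: gG => i; rewrite /= in_itv /= -ler_norml !mxE normrM normfV.
  by rewrite (ger0_norm (enorm_ge0 x)) mulrC ler_pdivrMr // mul1r coord_le_enorm.
Qed.

(** The quadratic term makes the radial majorant of g, which is only
    nondecreasing, strictly increasing. *)
Lemma majorant_K (R : realType) (n : nat) (g : 'cV[R]_n -> R)
    (k : R) : continuous g -> g 0 = 0 -> 0 < k ->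
  exists2 alpha : R -> R, everywhere_K alpha &
    forall (x : 'cV[R]_n) (s : R), enorm x <= s -> k * s ^+ 2 + g x <= alpha s.
Proof.
move=> gc g0 k0; have [G [Gc G0 Gle gG]] := radial_majorant gc g0.
exists (fun s => k * s ^+ 2 + G s); last first.
  move=> x s xs; rewrite lerD2l; apply: le_trans (gG x) _.
  by apply: Gle; rewrite ?enorm_ge0.
split.
- move=> s; apply: cvgD; last exact: Gc.
  by apply: cvgMl_tmp; exact: exprn_continuous.
- by rewrite expr0n /= mulr0 add0r.
- move=> s1 s2 s10 s12; apply: ltr_leD; last by apply: Gle => //; exact: ltW.
  by rewrite ltr_pM2l // ltr_sqr ?nnegrE // ltW // (le_lt_trans s10).
Qed.

(** * Calculus on the half line *)

(** Away from 0 the half line is a neighbourhood of t, so the restriction of the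
    difference quotients is harmless. *)
Lemma hderivable_is_derive (R : realType) (V : normedModType R) (f : R -> V)
    (t : R) : 0 < t -> hderivable f t -> is_derive t 1 f (hderive f t).
Proof.
move=> t0 fd.
suff E : (fun h : R => h^-1 *: ((f \o shift t) (h *: 1) - f t)) @ 0^' =
    hquot f t s @[s --> within `[0, +oo[ t^'].
  by split; rewrite /derivable /derive E.
have -> : within `[0, +oo[ t^' = t^'.
  apply/seteqP; split=> A /=; last exact: cvg_within.
  rewrite /within /= => At.
  have : \forall x \near t^', 0 < x by exact: nbhs_dnbhs (lt_nbhsr t0).
  by move: At; apply: filterS2 => x + x0; apply; rewrite /= in_itv /= ltW.
apply/funext => A; apply/propext.
(* Translation by [t] carries punctured neighbourhoods of 0 to those of [t]. *)
pose P (s : R^o) := s != t -> A ((s - t)^-1 *: (f s - f t)).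
have shiftE := @near_shift _ R^o 0 t P; rewrite subr0 in shiftE.
change ((\forall h \near (0 : R), h != 0 -> A (h^-1 *: (f (h *: 1 + t) - f t))) <->
  (\near t, P t)).
rewrite shiftE; split; apply: filterS => h; rewrite /P /= addrK [h%:A]mulr1;
  move=> + h0; apply; apply: contra_neq h0 => E; first by rewrite E add0r.
by apply: (addIr t); rewrite E add0r.
Qed.

Lemma hderivable_hcontinuous (R : realType) (V : normedModType R) (f : R -> V)
    (t : R) : 0 <= t -> hderivable f t -> hcontinuous f t.
Proof.
move=> t0 fd; set F := within `[0, +oo[ t^'.
have st : (s - t) @[s --> F] --> (0 : R).
  rewrite -(subrr t); apply: cvgB; last exact: cvg_cst.
  exact: (cvg_trans (cvg_within _) (cvg_within _)).
have : (s - t) *: hquot f t s + f t @[s --> F] --> 0 *: hderive f t + f t.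
  by apply: cvgD; [exact: cvgZ | exact: cvg_cst].
rewrite scale0r add0r => /cvgrPdist_lt fF; apply/cvgrPdist_lt => e e0.
move: (fF e e0); rewrite /F !near_withinE; apply: filterS => s Hs s0.
have [->|nst] := eqVneq s t; first by rewrite subrr normr0.
have := Hs nst s0.
by rewrite /hquot scalerA divff ?subr_eq0 // scale1r subrK.
Qed.

Lemma is_derive_coord (R : realType) (n : nat) (f : R -> 'cV[R]_n) (t : R)
    (v : 'cV[R]_n) (i : 'I_n) :
  is_derive t 1 f v -> is_derive t 1 (fun s => f s i 0) (v i 0).
Proof.
move=> [fd <-]; split; first by move/derivable_mxP: fd; apply.
by rewrite derive_mx // mxE.
Qed.

Lemma is_derive_bilin (R : realType) (n : nat) (A : 'M[R]_n)
    (u v : R -> 'cV[R]_n) (t : R) (du dv : 'cV[R]_n) :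
  is_derive t 1 u du -> is_derive t 1 v dv ->
  is_derive t 1 (fun s => bilin A (u s) (v s)) (bilin A du (v t) + bilin A (u t) dv).
Proof.
move=> ud vd; have ui i := is_derive_coord i ud; have vi i := is_derive_coord i vd.
rewrite (_ : (fun s => _) = \sum_i \sum_j
    (A i j \*: ((fun s => u s i 0) * (fun s => v s j 0)))); last first.
  apply/funext => s; rewrite bilinE fct_sumE; apply: eq_bigr => i _.
  rewrite fct_sumE; apply: eq_bigr => j _ /=.
  by rewrite mulrAC mulrC.
apply: is_derive_eq; rewrite !bilinE -big_split /=; apply: eq_bigr => i _.
rewrite -big_split /=; apply: eq_bigr => j _.
by rewrite /GRing.scale /=; ring.
Qed.

(** The gradient is built from partial derivatives; differentiability is what
    makes them determine the whole differential. *)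
Lemma gradientE (R : realType) (n : nat) (g : 'cV[R]_n -> R) (x v : 'cV[R]_n) :
  differentiable g x -> 'd g x v = bilin 1%:M v (gradient g x).
Proof.
move=> gd; rewrite bilin1E {1}(matrix_sum_delta v) linear_sum.
by apply: eq_bigr => i _; rewrite big_ord1 linearZ /= mxE -deriveE.
Qed.

Lemma is_derive_comp_gradient (R : realType) (n : nat) (g : 'cV[R]_n -> R)
    (x : R -> 'cV[R]_n) (t : R) (v : 'cV[R]_n) :
  differentiable g (x t) -> is_derive t 1 x v ->
  is_derive t 1 (fun s => g (x s)) (bilin 1%:M v (gradient g (x t))).
Proof.
move=> gd [xd xv]; have /derivable1_diffP xd' := xd.
have gxd : differentiable (g \o x) t by exact: differentiable_comp.
split; first exact/derivable1_diffP.
by rewrite deriveE // diff_comp //= -xv deriveE // gradientE.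
Qed.

Lemma hcontinuous_bilin (R : realType) (n : nat) (A : 'M[R]_n)
    (u v : R -> 'cV[R]_n) (t : R) :
  hcontinuous u t -> hcontinuous v t ->
  hcontinuous (fun s => bilin A (u s) (v s)) t.
Proof.
rewrite /hcontinuous => uc vc.
have coord (f : R -> 'cV[R]_n) i : hcontinuous f t ->
    hcontinuous (fun s => f s i 0) t.
  move=> fc; apply: (@continuous_cvg _ _ _ _ _ f (fun M => M i 0) (f t)) fc.
    exact: coord_continuous.
rewrite bilinE; under eq_fun do rewrite bilinE.
apply: cvg_big => [|i _]; first exact: add_continuous.
apply: cvg_big => [|j _]; first exact: add_continuous.
apply: cvgM; last exact: coord vc.
by apply: cvgM; [exact: coord uc | exact: cvg_cst].
Qed.

(** * The Lyapunov function *)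

Lemma sqr_enorm_col_mx (R : realType) (m n : nat) (x : 'cV[R]_m) (y : 'cV[R]_n) :
  enorm (col_mx x y) ^+ 2 = enorm x ^+ 2 + enorm y ^+ 2.
Proof.
rewrite !sqr_enorm big_split_ord /=; congr (_ + _); apply: eq_bigr => i _.
  by rewrite col_mxEu.
by rewrite col_mxEd.
Qed.

Lemma signal_norm_ub (R : realType) (n : nat) (u : R -> 'cV[R]_n) (t : R) :
  (signal_norm u < +oo)%E -> 0 <= t -> enorm (u t) <= fine (signal_norm u).
Proof.
move=> ub t0; have tu : ((enorm (u t))%:E <= signal_norm u)%E.
  by apply: ereal_sup_ubound; exists t => //=; rewrite in_itv /= t0.
rewrite -lee_fin fineK // fin_numElt ub andbT.
by apply: lt_le_trans tu; rewrite ltNyr.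
Qed.

(** The energy with a cross term; e / 2 x^T C x is the term whose derivative
    cancels the x^T C v coming from the cross term. *)
Definition lyapunov (R : realType) (r : nat) (M C : 'M[R]_r)
    (g : 'cV[R]_r -> R) (e : R) (x v : 'cV[R]_r) : R :=
  2^-1 * bilin M v v + g x + e * bilin M x v + e / 2 * bilin C x x.

(** Completing the square: c times the difference of the two sides, each minimum
    being replaced by the relevant argument, is
    (m c - 4 e mu^2) Y^2 / 4 + e (c X / 2 - mu Y)^2. *)
Lemma young_coercive (R : realFieldType) (m mu c e X Y : R) :
  0 < c -> 0 < e -> 4 * e * mu ^+ 2 <= m * c ->
  Num.min (m / 4) (e * c / 4) * (X ^+ 2 + Y ^+ 2) <=
  2^-1 * (m * Y ^+ 2) - e * (mu * (X * Y)) + e / 2 * (c * X ^+ 2).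
Proof.
move=> c0 e0 emu; set a := Num.min _ _.
have am : a <= m / 4 by rewrite ge_min lexx.
have ac : a <= e * c / 4 by rewrite ge_min lexx orbT.
have h1 : a * X ^+ 2 <= e * c / 4 * X ^+ 2 by rewrite ler_wpM2r ?sqr_ge0.
have h2 : a * Y ^+ 2 <= m / 4 * Y ^+ 2 by rewrite ler_wpM2r ?sqr_ge0.
have h3 : 0 <= (m * c - 4 * e * mu ^+ 2) * Y ^+ 2.
  by rewrite mulr_ge0 ?sqr_ge0 // subr_ge0.
have h4 : 0 <= e * (c * X / 2 - mu * Y) ^+ 2 by rewrite mulr_ge0 ?sqr_ge0 // ltW.
rewrite mulrDr; apply: le_trans (lerD h1 h2) _.
rewrite -subr_ge0 -(pmulr_rge0 _ c0).
rewrite [X in 0 <= X](_ : _ = (m * c - 4 * e * mu ^+ 2) * Y ^+ 2 / 4 +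
  e * (c * X / 2 - mu * Y) ^+ 2); last by field.
by rewrite addr_ge0 // divr_ge0.
Qed.

Lemma lyapunov_ge (R : realType) (r : nat) (M C : 'M[R]_r)
    (g : 'cV[R]_r -> R) (e m c : R) (x v : 'cV[R]_r) :
  (forall w, m * enorm w ^+ 2 <= bilin M w w) ->
  (forall w, c * enorm w ^+ 2 <= bilin C w w) ->
  0 < c -> 0 < e -> 4 * e * frobenius M ^+ 2 <= m * c -> 0 <= g x ->
  Num.min (m / 4) (e * c / 4) * (enorm x ^+ 2 + enorm v ^+ 2) <=
  lyapunov M C g e x v.
Proof.
move=> Mm Cc c0 e0 eM gx.
apply: le_trans (young_coercive (enorm x) (enorm v) c0 e0 eM) _.
rewrite /lyapunov.
have h1 : e * - (frobenius M * (enorm x * enorm v)) <= e * bilin M x v.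
  rewrite ler_wpM2l ?(ltW e0) //.
  by have := bilin_le M x v; rewrite ler_norml => /andP[].
have h2 : e / 2 * (c * enorm x ^+ 2) <= e / 2 * bilin C x x.
  by rewrite ler_wpM2l // divr_ge0 // ltW.
by have := Mm v; lra.
Qed.

Lemma lyapunov_le (R : realType) (r : nat) (M C : 'M[R]_r)
    (g : 'cV[R]_r -> R) (e N : R) (x v : 'cV[R]_r) :
  0 <= e -> 0 <= N -> enorm x ^+ 2 + enorm v ^+ 2 = N ^+ 2 ->
  lyapunov M C g e x v <=
  (frobenius M + e * frobenius M + e * frobenius C) * N ^+ 2 + g x.
Proof.
move=> e0 N0 EN; rewrite /lyapunov.
have xN : enorm x <= N.
  by rewrite -ler_sqr ?nnegrE ?enorm_ge0 // -EN lerDl sqr_ge0.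
have vN : enorm v <= N.
  by rewrite -ler_sqr ?nnegrE ?enorm_ge0 // -EN lerDr sqr_ge0.
have le_N2 (A : 'M[R]_r) y z : enorm y <= N -> enorm z <= N ->
    bilin A y z <= frobenius A * N ^+ 2.
  move=> yN zN; apply: le_trans (ler_norm _) _.
  apply: le_trans (bilin_le _ _ _) _; rewrite ler_wpM2l ?frobenius_ge0 //.
  by rewrite expr2 ler_pM ?enorm_ge0.
have h1 := le_N2 M v v vN vN.
have h2 : e * bilin M x v <= e * (frobenius M * N ^+ 2).
  by rewrite ler_wpM2l // le_N2.
have h3 : e * bilin C x x <= e * (frobenius C * N ^+ 2).
  by rewrite ler_wpM2l // le_N2.
have h4 : 0 <= frobenius M * N ^+ 2 by rewrite mulr_ge0 ?frobenius_ge0 ?sqr_ge0.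
have h5 : 0 <= e * (frobenius C * N ^+ 2).
  by rewrite !mulr_ge0 ?frobenius_ge0 ?sqr_ge0.
lra.
Qed.

(** Here f stands for the input force B u(t).  The terms v^T grad g of the
    kinetic and potential parts cancel, and so do the two e x^T C v. *)
Lemma is_derive_lyapunov (R : realType) (r : nat) (M C : 'M[R]_r)
    (g : 'cV[R]_r -> R) (e t : R) (x v : R -> 'cV[R]_r) (w f : 'cV[R]_r) :
  M = M^T -> C = C^T -> differentiable g (x t) ->
  is_derive t 1 x (v t) -> is_derive t 1 v w ->
  M *m w + C *m v t + gradient g (x t) = f ->
  is_derive t 1 (fun s => lyapunov M C g e (x s) (v s))
    (- bilin C (v t) (v t) + e * bilin M (v t) (v t)
     - e * bilin 1%:M (x t) (gradient g (x t)) + bilin 1%:M (v t + e *: x t) f).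
Proof.
move=> Ms Cs gd xd vd E.
have MvE y : bilin M y w = bilin 1%:M y f - bilin C y (v t)
    - bilin 1%:M y (gradient g (x t)).
  have -> : bilin M y w = bilin 1%:M y (M *m w) by rewrite /bilin mulmx1 mulmxA.
  have -> : bilin C y (v t) = bilin 1%:M y (C *m v t) by rewrite /bilin mulmx1 mulmxA.
  by rewrite -E !bilinDr; ring.
have dvv := is_derive_bilin M vd vd.
have dxv := is_derive_bilin M xd vd.
have dxx := is_derive_bilin C xd xd.
have dg := is_derive_comp_gradient gd xd.
rewrite (_ : (fun s => _) = ((2^-1 \*: (fun s => bilin M (v s) (v s)) +
   (fun s => g (x s))) + e \*: (fun s => bilin M (x s) (v s))) +
   (e / 2) \*: (fun s => bilin C (x s) (x s))); last by [].
apply: is_derive_eq; rewrite /GRing.scale /=.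
rewrite (bilin_sym w (v t) Ms) (bilin_sym (v t) (x t) Cs) !MvE bilinDl bilinZl.
by rewrite (bilin_sym (x t) (v t) Cs); field.
Qed.

(** Half of the quadratic decay absorbs the input term (1 + e) N b U, which is
    what the lower bound on N in terms of U permits. *)
Lemma lyapunov_dissipation (R : realType) (r : nat) (M C : 'M[R]_r)
    (c g0 e b N U : R) (x v dg f : 'cV[R]_r) :
  (forall w, c * enorm w ^+ 2 <= bilin C w w) ->
  g0 * enorm x ^+ 2 <= bilin 1%:M x dg ->
  0 < c -> 0 < g0 -> 0 < e -> e * frobenius M <= c / 2 ->
  0 <= N -> enorm x ^+ 2 + enorm v ^+ 2 = N ^+ 2 ->
  enorm f <= b * U -> 0 <= b -> 0 <= U ->
  2 * (1 + e) * b / Num.min (c / 2) (e * g0) * U <= N ->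
  - bilin C v v + e * bilin M v v - e * bilin 1%:M x dg
    + bilin 1%:M (v + e *: x) f <= - (Num.min (c / 2) (e * g0) / 2 * N ^+ 2).
Proof.
move=> Cc Hg c0 g00 e0 eM N0 EN fU b0 U0; set a := Num.min _ _ => rN.
have a0 : 0 < a by rewrite lt_min divr_gt0 ?mulr_gt0.
have ac : a <= c / 2 by rewrite ge_min lexx.
have ag : a <= e * g0 by rewrite ge_min lexx orbT.
have xN : enorm x <= N.
  by rewrite -ler_sqr ?nnegrE ?enorm_ge0 // -EN lerDl sqr_ge0.
have vN : enorm v <= N.
  by rewrite -ler_sqr ?nnegrE ?enorm_ge0 // -EN lerDr sqr_ge0.
have hf : bilin 1%:M (v + e *: x) f <= (1 + e) * (N * (b * U)).
  rewrite bilinDl bilinZl mulrDl mul1r; apply: lerD; last (rewrite ler_wpM2l ?(ltW e0) //).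
    apply: le_trans (ler_norm _) _; apply: le_trans (dot_le_enorm _ _) _.
    by rewrite ler_pM ?enorm_ge0.
  apply: le_trans (ler_norm _) _; apply: le_trans (dot_le_enorm _ _) _.
  by rewrite ler_pM ?enorm_ge0.
have hM : e * bilin M v v <= c / 2 * enorm v ^+ 2.
  apply: le_trans (_ : e * frobenius M * enorm v ^+ 2 <= _); last first.
    by rewrite ler_wpM2r ?sqr_ge0.
  rewrite -mulrA ler_wpM2l ?(ltW e0) // expr2.
  by apply: le_trans (ler_norm _) (bilin_le _ _ _).
have hg : e * g0 * enorm x ^+ 2 <= e * bilin 1%:M x dg.
  by rewrite -mulrA ler_wpM2l // ltW.
have h1 : a * enorm x ^+ 2 <= e * g0 * enorm x ^+ 2 by rewrite ler_wpM2r ?sqr_ge0.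
have h2 : a * enorm v ^+ 2 <= c / 2 * enorm v ^+ 2 by rewrite ler_wpM2r ?sqr_ge0.
have hN : (1 + e) * (N * (b * U)) <= a / 2 * N ^+ 2.
  have : a / 2 * (2 * (1 + e) * b / a * U) * N <= a / 2 * N * N.
    by rewrite ler_wpM2r // ler_wpM2l // divr_ge0 // ltW.
  rewrite (_ : a / 2 * _ * N = (1 + e) * (N * (b * U))) ?expr2 ?mulrA //.
  by field; rewrite lt0r_neq0.
have hC := Cc v; rewrite -EN; rewrite -EN in hN; lra.
Qed.

(** * Input-to-state stability *)

Theorem theorem2 (R : realType) (r nu : nat) (hr : (1 <= r)%N) (hnu : (1 <= nu)%N)
  (M C : 'M[R]_r) (B : 'M[R]_(r, nu)) (g : 'cV[R]_r -> R)
  (g_diff : forall x : 'cV[R]_r, differentiable g x)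
  (M_sym : M = M^T) (M_pos : posdefmx M)
  (C_sym : C = C^T) (C_pos : posdefmx C)
  (g_pos : posdef_fun g)
  (g_grad : exists g0 : R, 0 < g0 /\
     forall x : 'cV[R]_r, g0 * enorm x ^+ 2 <= (x^T *m gradient g x) 0 0) :
  ISS M C B g.
Proof.
have [g0 [g00 Hg]] := g_grad; have [gz gp] := g_pos.
have gge0 x : 0 <= g x by have [->|/gp/ltW //] := eqVneq x 0; rewrite gz.
have [m m0 Mm] := posdef_coercive M_sym M_pos.
have [c c0 Cc] := posdef_coercive C_sym C_pos.
pose mu := frobenius M + 1.
have mu0 : 0 < mu by rewrite ltr_wpDl ?frobenius_ge0.
have Mmu : frobenius M <= mu by rewrite lerDl.
(* The first argument of the minimum serves the decay along v, the second one
   the lower bound of V. *)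
pose e := Num.min (c / (2 * mu)) (m * c / (4 * mu ^+ 2)).
have e0 : 0 < e by rewrite lt_min !divr_gt0 ?mulr_gt0 ?exprn_gt0.
have eM1 : e * frobenius M <= c / 2.
  apply: le_trans (_ : e * mu <= _); first by rewrite ler_wpM2l // ltW.
  have : e * (2 * mu) <= c by rewrite -ler_pdivlMr ?mulr_gt0 // ge_min lexx.
  by lra.
have eM2 : 4 * e * frobenius M ^+ 2 <= m * c.
  apply: le_trans (_ : e * (4 * mu ^+ 2) <= _); last first.
    by rewrite -ler_pdivlMr ?mulr_gt0 ?exprn_gt0 // ge_min lexx orbT.
  rewrite (mulrC 4) -mulrA ler_wpM2l ?(ltW e0) // ler_wpM2l //.
  by rewrite ler_sqr ?nnegrE ?frobenius_ge0 // ltW.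
pose a1 := Num.min (m / 4) (e * c / 4).
have a10 : 0 < a1 by rewrite lt_min !divr_gt0 ?mulr_gt0.
pose a := Num.min (c / 2) (e * g0) / 2.
have a0 : 0 < a by rewrite divr_gt0 // lt_min divr_gt0 ?mulr_gt0.
pose b := frobenius B.
have b0 : 0 <= b := frobenius_ge0 B.
pose k0 := frobenius M + e * frobenius M + e * frobenius C.
have k00 : 0 <= k0.
  by rewrite !addr_ge0 ?mulr_ge0 ?frobenius_ge0 // ltW.
have gc : continuous g by move=> x; exact: differentiable_continuous.
have [alpha alphaK alphaV] := majorant_K gc gz
  (ltr_wpDl k00 ltr01 : 0 < k0 + 1).
(* Adding 1 makes the gain strictly increasing even when B = 0. *)
pose k := 2 * (1 + e) * b / Num.min (c / 2) (e * g0) + 1.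
have k1 : 2 * (1 + e) * b / Num.min (c / 2) (e * g0) <= k by rewrite lerDl.
have k_gt0 : 0 < k.
  apply: ltr_wpDl => //; rewrite divr_ge0 ?mulr_ge0 ?addr_ge0 ?(ltW e0) //.
  by rewrite le_min divr_ge0 ?mulr_ge0 // ltW.
have a1V0 : 0 < a1^-1 by rewrite invr_gt0.
have sK := everywhere_K_sqrt R.
pose gamma U := Num.sqrt (a1^-1 * alpha (k * U)).
exists (decay alpha a a1^-1), gamma; split.
- exact: decay_KL.
- apply: everywhere_K_K_function.
  exact: (everywhere_K_comp sK (everywhere_K_comp (everywhere_K_scale a1V0)
    (everywhere_K_comp alphaK (everywhere_K_scale k_gt0)))).
move=> u uoo x xsol t t0; set U := fine (signal_norm u).
have uU (s : R) : 0 <= s -> enorm (u s) <= U by exact: signal_norm_ub.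
have U0 : 0 <= U := le_trans (enorm_ge0 (u 0)) (uU 0 (lexx 0)).
pose v := hderive x; pose N s := enorm (full_state x s).
have N0 s : 0 <= N s := enorm_ge0 _.
have EN s : enorm (x s) ^+ 2 + enorm (v s) ^+ 2 = N s ^+ 2.
  by rewrite /N sqr_enorm_col_mx.
have xN s : enorm (x s) <= N s.
  by rewrite -ler_sqr ?nnegrE ?enorm_ge0 // -EN lerDl sqr_ge0.
pose V s := lyapunov M C g e (x s) (v s).
have Vge s : a1 * N s ^+ 2 <= V s by rewrite -EN; exact: lyapunov_ge.
have Vle s : V s <= alpha (N s).
  apply: le_trans (lyapunov_le M C g (ltW e0) (N0 s) (EN s)) _.
  by apply: le_trans (alphaV _ _ (xN s)); rewrite lerD2r ler_wpM2r ?sqr_ge0 ?lerDl.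
have NV s y : V s <= y -> N s <= Num.sqrt (a1^-1 * y).
  move=> Vy; rewrite -(ger0_norm (N0 s)) -sqrtr_sqr ler_wsqrtr //.
  by rewrite mulrC ler_pdivlMr // mulrC (le_trans (Vge s)).
change (N t <= decay alpha a a1^-1 (N 0) t + gamma U).
have gammaU0 : 0 <= gamma U by exact: sqrtr_ge0.
move: t0; rewrite le_eqVlt => /predU1P[<-|t0].
  by rewrite /decay eqxx; apply: le_trans (NV 0 _ (Vle 0)) _; rewrite lerDl.
have Vc (s : R) : 0 <= s -> hcontinuous V s.
  move=> s0; have [xd vd _] := xsol s s0.
  have xc := hderivable_hcontinuous s0 xd.
  have vc := hderivable_hcontinuous s0 vd.
  have cst (y : R) : y @[_ --> within `[0, +oo[ (nbhs s)] --> y by exact: cvg_cst.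
  apply: cvgD; last by apply: cvgM; [exact: cst | exact: hcontinuous_bilin].
  apply: cvgD; last by apply: cvgM; [exact: cst | exact: hcontinuous_bilin].
  apply: cvgD; first by apply: cvgM; [exact: cst | exact: hcontinuous_bilin].
  exact: (continuous_cvg _ (gc (x s)) xc).
pose dV s := - bilin C (v s) (v s) + e * bilin M (v s) (v s)
  - e * bilin 1%:M (x s) (gradient g (x s))
  + bilin 1%:M (v s + e *: x s) (B *m u s).
have Vd (s : R) : 0 < s -> is_derive s 1 V (dV s).
  move=> s0; have [xd vd E] := xsol s (ltW s0).
  exact: (is_derive_lyapunov e M_sym C_sym (g_diff (x s))
    (hderivable_is_derive s0 xd) (hderivable_is_derive s0 vd) E).
have dVN (s : R) : 0 < s -> k * U <= N s -> dV s <= - (a * N s ^+ 2).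
  move=> s0 kN; apply: (@lyapunov_dissipation _ _ M C c g0 e b (N s) U) => //.
  - by have := Hg (x s); rewrite /bilin mulmx1.
  - by apply: le_trans (enorm_mulmx _ _) _; rewrite ler_wpM2l // uU // ltW.
  - by apply: le_trans kN; rewrite ler_wpM2r.
have Vnn (s : R) : 0 <= s -> 0 <= V s.
  by move=> _; apply: le_trans (Vge s); rewrite mulr_ge0 ?sqr_ge0 // ltW.
have kU0 : 0 <= k * U by rewrite mulr_ge0 // ltW.
have := dissipation_bound Vc Vd Vnn (fun s _ => N0 s) (fun s _ => Vle s)
  (fun s1 s2 => @everywhere_K_le _ _ s1 s2 alphaK) a0 kU0 dVN t0.
rewrite le_max => /orP[] /NV Nt; apply: le_trans Nt _.
  by rewrite /decay gt_eqF // [X in alpha (Num.sqrt X)]mulrC lerDl.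
by rewrite lerDr /decay gt_eqF // sqrtr_ge0.
Qed.
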